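(* Consider a one-dimensional finite volume (FV) method on $N$ cells whose update from time level $m$ to time level $m+1$ has the form $$U_i^{m+1}=\sum_{\ell\in\mathcal{S}_i^m} d_{i,\ell}^m\,U_\ell^m,\qquad i=1,\ldots,N,$$ where $\mathcal{S}_i^m\subseteq\{1,\ldots,N\}$ is the stencil used to update $U_i^{m+1}$ and the real coefficients $d_{i,\ell}^m$ ($\ell\in\mathcal{S}_i^m$) may depend on the numerical solution $\{U_j^m\}_{j=1}^N$. For each $\ell\in\{1,\ldots,N\}$ let $\mathcal{E}_\ell^m=\{i\in\{1,\ldots,N\}:\ \ell\in\mathcal{S}_i^m\}$. (1) The method is mass conservative, i.e. $\sum_{i} U_i^{m+1}=\sum_{i}U_i^m$, when $$\sum_{i\in\mathcal{E}_\ell^m} d_{i,\ell}^m=1\qquad\text{for all }\ell\in\{1,\ldots,N\}.\qquad( * )$$ (2) If the method is linear, i.e. the coefficients $d_{i,\ell}^m$ are independent of the numerical solution $\{U_j^m\}_{j=1}^N$, then condition $( * )$ is also necessary for mass conservation.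
   Context: The domain is partitioned uniformly into $N$ cells $I_1,\ldots,I_N$ of equal size, and $U_i^m\in\mathbb{R}$ denotes the numerical cell average on $I_i$ at time step $t^m$. The index sets $\mathcal{S}_i^m$ (stencils) are given as part of the scheme. The set $\mathcal{E}_\ell^m$ is the region of influence of $U_\ell^m$: the indices of those cells whose updated value $U_i^{m+1}$ receives a contribution from $U_\ell^m$. Mass conservation of the method means that $\sum_{i=1}^N U_i^{m+1}=\sum_{i=1}^N U_i^m$ holds for arbitrary numerical data $\{U_j^m\}_{j=1}^N\in\mathbb{R}^N$. When the coefficients depend on the numerical solution, condition $( * )$ is understood for the coefficients evaluated at that solution. *)

(* Defs.v *)
From mathcomp Require Import all_boot all_order all_algebra.
From mathcomp Require Import reals.

Set Implicit Arguments.
Unset Strict Implicit.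
Unset Printing Implicit Defensive.

Import GRing.Theory.
Local Open Scope ring_scope.

(* The cells I_1, ..., I_N are indexed by 'I_N, i.e. from 0
   to N.-1, and the numerical data {U_j^m}_j is a row vector U with
   U_j^m = U 0 j. *)

(* [coeff m U i l] is d_{i,l}^m evaluated at the numerical solution U at time
   level m. It is only meaningful for [l \in stencil m i]: none of the notions
   below looks at its values outside the stencil. *)
Record fv_method (R : realType) (N : nat) := FVMethod {
  stencil : nat -> 'I_N -> {set 'I_N};
  coeff : nat -> 'rV[R]_N -> 'I_N -> 'I_N -> R
}.

Definition update (R : realType) (N : nat) (A : fv_method R N) (m : nat)
    (U : 'rV[R]_N) : 'rV[R]_N :=
  \row_(i < N) \sum_(l in stencil A m i) coeff A m U i l * U 0 l.

Definition influence (R : realType) (N : nat) (A : fv_method R N) (m : nat)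
    (l : 'I_N) : {set 'I_N} :=
  [set i | l \in stencil A m i].

Definition mass (R : realType) (N : nat) (U : 'rV[R]_N) : R :=
  \sum_(i < N) U 0 i.

Definition mass_conservative (R : realType) (N : nat) (A : fv_method R N)
    (m : nat) : Prop :=
  forall U : 'rV[R]_N, mass (update A m U) = mass U.

Definition unit_influence_sums (R : realType) (N : nat) (A : fv_method R N)
    (m : nat) (U : 'rV[R]_N) : Prop :=
  forall l : 'I_N, \sum_(i in influence A m l) coeff A m U i l = 1.

(* Linear in the sense that the coefficients do not depend on the numerical
   solution. *)
Definition linear_method (R : realType) (N : nat) (A : fv_method R N)
    (m : nat) : Prop :=
  forall (U V : 'rV[R]_N) (i l : 'I_N),
    l \in stencil A m i -> coeff A m U i l = coeff A m V i l.

(* Main.v *)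
(** Exchanging the order of summation, the mass after one step is the sum of
    the U_l weighted by the influence sums. These weights being 1 gives
    conservation; conversely, testing on the unit vector e_l isolates the l-th
    weight, evaluated at e_l, and linearity transports it to any solution. *)
Require Import Defs.
From mathcomp Require Import all_boot all_order all_algebra.
From mathcomp Require Import reals.

Import GRing.Theory.

Lemma mass_update (R : realType) (N : nat) (A : fv_method R N) (m : nat)
    (U : 'rV[R]_N) :
  mass (update A m U) =
    (\sum_l (\sum_(i in influence A m l) coeff A m U i l) * U ord0 l)%R.
Proof.
rewrite /mass; under eq_bigr do rewrite mxE.
rewrite (exchange_big_dep xpredT) //=; apply: eq_bigr => l _.
by rewrite mulr_suml; apply: eq_bigl => i; rewrite inE.
Qed.

(** Arbitrary weights [c] let one identity serve twice: with the influence sums, and with constant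
    weight 1 for the mass of a unit vector. *)
Lemma sum_mul_delta_row (R : nzRingType) (N : nat) (c : 'I_N -> R) (l : 'I_N) :
  (\sum_k c k * (delta_mx ord0 l : 'rV[R]_N) ord0 k = c l)%R.
Proof.
rewrite (bigD1 l) //= big1 => [|k /negPf kl]; first by rewrite mxE !eqxx mulr1 addr0.
by rewrite mxE kl andbF mulr0.
Qed.

Lemma mass_delta_row (R : realType) (N : nat) (l : 'I_N) :
  mass (delta_mx ord0 l : 'rV[R]_N) = 1%R.
Proof.
rewrite -[RHS](sum_mul_delta_row R N (fun=> 1%R) l).
by apply: eq_bigr => k _; rewrite mul1r.
Qed.

(** Only the coefficients at this one [U] enter, so solution-dependent coefficients are covered. *)
Lemma unit_influence_sums_mass (R : realType) (N : nat) (A : fv_method R N)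
    (m : nat) (U : 'rV[R]_N) :
  unit_influence_sums A m U -> mass (update A m U) = mass U.
Proof.
by move=> AU; rewrite mass_update; apply: eq_bigr => l _; rewrite AU mul1r.
Qed.

Theorem theorem2p1 (R : realType) (N : nat) (A : fv_method R N) (m : nat) :
  (forall U : 'rV[R]_N,
     unit_influence_sums A m U -> mass (update A m U) = mass U) /\
  ((forall U : 'rV[R]_N, unit_influence_sums A m U) ->
     mass_conservative A m) /\
  (linear_method A m -> mass_conservative A m ->
     forall U : 'rV[R]_N, unit_influence_sums A m U).
Proof.
split; first exact: unit_influence_sums_mass.
split=> [AU U|linA consA U l]; first exact: unit_influence_sums_mass.
have := consA (delta_mx ord0 l).
rewrite mass_update sum_mul_delta_row mass_delta_row => <-.
(* Every [i] in the influence set of [l] has [l] in its stencil, which is where [linA] equates the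
   coefficients at [U] and at the unit vector. *)
by apply: eq_bigr => i; rewrite inE => /linA.
Qed.
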